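(* Consider linear search where the origin is the bottom of a symmetric valley: the robot moves with constant acceleration $c>0$ when moving towards the origin (starting from rest at each turning point, so its speed at time $t$ after turning is $ct$) and with unit speed when moving away from the origin. Let $D=\{1,2,2^2,\ldots\}$ be the doubling strategy. Then for any $d\ge1$, $$\sigma_D(d) \le 5 + O(d^{-1/2}).$$ Furthermore, $\sigma^*\ge 5$.
   Context: A robot starts at the origin of the real line and searches for a stationary target at an unknown point at distance $d$ from the origin (on either side). A zig-zag strategy is an infinite sequence $X=\{x_k\}_{k\ge1}$ of positive reals with $x_k<x_{k+2}$ for all $k$; the zig-zag search with strategy $X$ proceeds in rounds $k=1,2,\dots$: in an odd (resp. even) round the robot moves right (resp. left) from the origin a distance $x_k$, stopping if it reaches the target, and otherwise turns and returns to the origin. $\sigma_X(d)$ denotes the ratio between the time the robot using $X$ needs to reach a target at distance $d$ (worst case over the target being at $+d$ or $-d$) and the time an omniscient robot, knowing the target's location and obeying the same movement rules, needs to travel from the origin directly to the target. The competitive ratio is $\sigma_X=\sup_{d>1}\sigma_X(d)$, and $\sigma^*$ denotes the optimal (infimum over all strategies) competitive ratio. The $O(d^{-1/2})$ term has constant depending only on $c$. *)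

(* Defs.v *)
From mathcomp Require Import all_boot all_order all_algebra.
From mathcomp Require Import all_classical all_reals all_analysis.
Set Implicit Arguments.
Unset Strict Implicit.
Unset Printing Implicit Defensive.
Import Order.TTheory GRing.Theory Num.Theory.
Import numFieldNormedType.Exports.
Local Open Scope classical_set_scope.
Local Open Scope ring_scope.

(* Speeds are functions of the time elapsed since the robot last started from
   the origin ([speed_away]) or last turned ([speed_toward]). *)
Definition speed_away {R : realType} (t : R) : R := 1.

Definition speed_toward {R : realType} (c : R) (t : R) : R := c * t.

Definition travelled {R : realType} (v : R -> R) (t : R) : R :=
  \int[lebesgue_measure]_(s in `[0, t]) v s.

(* First time at which the distance travelled is [x]. *)
Definition travel_time {R : realType} (v : R -> R) (x : R) : R :=
  inf [set t | 0 <= t /\ travelled v t = x].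

(* Rounds are numbered from 0: [X k] is x_(k+1), so the robot goes right in the
   rounds [k] with [k] even, and left in those with [k] odd. *)
Definition zigzag {R : realType} : set (nat -> R) :=
  [set X | forall k, 0 < X k /\ X k < X k.+2].

Definition doubling {R : realType} (k : nat) : R := 2 ^+ k.

Definition round_time {R : realType} (c x : R) : R :=
  travel_time speed_away x + travel_time (speed_toward c) x.

Definition round_start {R : realType} (c : R) (X : nat -> R) (k : nat) : R :=
  \sum_(i < k) round_time c (X i).

(* For a target at [z != 0]; the round goes to the side of [z], far enough. *)
Definition round_reaches {R : realType} (X : nat -> R) (z : R) (k : nat) : bool :=
  (odd k == (z < 0)) && (`|z| <= X k).

(* The infimum is attained at the first round reaching [z]; it is [+oo] if no
   round does. *)
Definition reach_time {R : realType} (c : R) (X : nat -> R) (z : R) : \bar R :=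
  ereal_inf [set (round_start c X k + travel_time speed_away `|z|)%:E |
             k in [set k | round_reaches X z k]].

Definition sigma {R : realType} (c : R) (X : nat -> R) (d : R) : \bar R :=
  (maxe (reach_time c X d) (reach_time c X (- d))
     * ((travel_time speed_away d)^-1)%:E)%E.

Definition competitive_ratio {R : realType} (c : R) (X : nat -> R) : \bar R :=
  ereal_sup [set sigma c X d | d in [set d : R | 1 < d]].

Definition optimal_ratio {R : realType} (c : R) : \bar R :=
  ereal_inf [set competitive_ratio c X | X in zigzag].

(* Main.v *)
Require Import Defs.
From mathcomp Require Import all_boot all_order all_algebra.
From mathcomp Require Import all_classical all_reals all_analysis.
From mathcomp Require Import ring lra.
Import Order.TTheory GRing.Theory Num.Theory.
Import numFieldNormedType.Exports.
Local Open Scope classical_set_scope.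
Local Open Scope ring_scope.

(* An excursion of length x takes time x + sqrt (2x/c).  For the doubling
   strategy the x_i before the successful round sum to at most 4d and the
   square roots form a geometric sum of order sqrt d, hence 5d + O(sqrt d).
   Conversely, even with a free return to the origin a target just beyond x_k
   costs x_1 + ... + x_(k+1) + x_k, so a ratio M < 5 would bound the partial
   sums by S_(k+1) <= (M - 1) (S_k - S_(k-1)), with M - 1 < 4; this makes
   S_(k+1) / S_k decrease by at least a fixed amount at each step. *)

(** * Closed forms for the two travel times *)

Section TravelTimes.
Context {R : realType}.
Implicit Types c t x : R.

Lemma travelled_away t : 0 <= t -> travelled speed_away t = t.
Proof.
move=> t0; rewrite /travelled /speed_away Rintegral_cst ?mul1r//.
rewrite [X in fine X]lebesgue_measure_itv/= lte_fin; case: ltP => [_|t0'] /=.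
  by rewrite subr0.
by apply/eqP; rewrite eq_le t0 t0'.
Qed.

Lemma travelled_toward c t : 0 <= t ->
  travelled (speed_toward c) t = c / 2 * t ^+ 2.
Proof.
rewrite le_eqVlt => /predU1P[<-|t0].
  by rewrite /travelled set_itv1 Rintegral_set1 expr0n/= mulr0.
pose F (s : R) : R := s ^+ 2 * (c / 2).
have cF : continuous F.
  by move=> s; apply: cvgM; [exact: exprn_continuous|exact: cvg_cst].
rewrite /travelled /Rintegral (@continuous_FTC2 _ _ F 0 t t0).
- by rewrite /F expr0n/= mul0r subr0 mulrC.
- apply: continuous_subspaceT => s.
  by apply: cvgM; [exact: cvg_cst|exact: cvg_id].
- split.
  + by move=> s _; apply: derivableM; [exact: exprn_derivable|exact: derivable_cst].
  + by apply: cvg_at_right_filter; exact: cF.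
  + by apply: cvg_at_left_filter; exact: cF.
- move=> s _; rewrite /F derive1Mr; last exact: exprn_derivable.
  by rewrite exp_derive1 /speed_toward expr1 /GRing.scale/=; field.
Qed.

Lemma travel_time_away x : 0 <= x -> travel_time speed_away x = x.
Proof.
move=> x0; rewrite /travel_time -[RHS](inf1 x); congr inf; apply/seteqP.
split=> t /=; first by move=> [t0]; rewrite travelled_away.
by move=> ->; rewrite travelled_away.
Qed.

(** The distance [c / 2 * t ^+ 2] is injective in [t >= 0], so the infimum defining [travel_time]
    runs over a singleton. *)
Lemma travel_time_toward c x : 0 < c -> 0 <= x ->
  travel_time (speed_toward c) x = Num.sqrt (2 * x / c).
Proof.
move=> c0 x0; rewrite /travel_time -[RHS]inf1; congr inf; apply/seteqP.
have q0 : 0 <= 2 * x / c by rewrite divr_ge0 ?mulr_ge0// ltW.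
split=> t /=.
  move=> [t0]; rewrite travelled_toward// => <-.
  rewrite (_ : 2 * _ / c = t ^+ 2); last by field; rewrite gt_eqF.
  by rewrite sqrtr_sqr ger0_norm.
move=> ->; rewrite travelled_toward ?sqrtr_ge0// sqr_sqrtr//.
by split=> //; field; rewrite gt_eqF.
Qed.

Lemma round_timeE c x : 0 < c -> 0 <= x ->
  round_time c x = x + Num.sqrt (2 * x / c).
Proof.
by move=> c0 x0; rewrite /round_time travel_time_away// travel_time_toward.
Qed.

End TravelTimes.

(** * Reducing ratio bounds to bounds on reach times *)

Section ReachTime.
Context {R : realType}.
Implicit Types (c d M z : R) (X : nat -> R).

Lemma sigma_le c X d M : 0 < d ->
  (sigma c X d <= M%:E)%E =
  (reach_time c X d <= (M * d)%:E)%E && (reach_time c X (- d) <= (M * d)%:E)%E.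
Proof.
move=> d0; rewrite /sigma travel_time_away ?(ltW d0)//.
by rewrite lee_pdivrMr// ge_max EFinM.
Qed.

Lemma reach_time_le c X z k : round_reaches X z k ->
  (reach_time c X z <= (round_start c X k + `|z|)%:E)%E.
Proof.
move=> Xzk; apply: ereal_inf_lbound; exists k => //.
by rewrite travel_time_away.
Qed.

(** The bound is an extended real so that [b] can be [+oo] when no round reaches [z]. *)
Lemma le_reach_time c X z (b : \bar R) :
  (forall k, round_reaches X z k -> (b <= (round_start c X k + `|z|)%:E)%E) ->
  (b <= reach_time c X z)%E.
Proof.
move=> bX; apply: le_ereal_inf_tmp => _ [k /= Xzk <-].
by rewrite travel_time_away//; exact: bX.
Qed.

End ReachTime.

(** * Upper bound for the doubling strategy *)

Section Doubling.
Context {R : realType}.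
Implicit Types (c d z : R).

(** The least power of 2 reaching the target overshoots by a factor at most 2; if its round goes to
    the wrong side, the next round costs one more factor 2. *)
Lemma doubling_reaches z : 1 <= `|z| ->
  exists2 k, round_reaches doubling z k & 2 ^+ k <= 4 * `|z|.
Proof.
move=> z1; have ex_n : exists n, `|z| <= 2 ^+ n.
  by exists (Num.bound `|z|); apply/ltW/upper_nthrootP.
have [n zn n_min] := ex_minnP ex_n.
have n2 : 2 ^+ n <= 2 * `|z|.
  case: n zn n_min => [|n] _ n_min; first by rewrite expr0; lra.
  rewrite exprS ler_pM2l// ltW// ltNge; apply/negP => /n_min.
  by rewrite ltnn.
have [en|en] := eqVneq (odd n) (z < 0).
  exists n; first by rewrite /round_reaches en eqxx.
  by lra.
exists n.+1; last by rewrite exprS; lra.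
apply/andP; split; first by move: en; rewrite /=; case: (odd n); case: (z < 0).
by apply: le_trans zn _; rewrite /doubling ler_weXn2l// ler1n.
Qed.

Lemma sum_sqrt_pow2 n :
  \sum_(i < n) Num.sqrt (2 ^+ i) <= (Num.sqrt 2 + 1) * Num.sqrt (2 ^+ n) :> R.
Proof.
set q : R := Num.sqrt 2.
have qE m : Num.sqrt (2 ^+ m) = q ^+ m
  by elim: m => [|m IH]; rewrite ?expr0 ?sqrtr1// !exprS sqrtrM// IH.
(* The geometric sum has denominator [q - 1], whose inverse is [q + 1]. *)
have q2 : (q - 1) * (q + 1) = 1.
  have : q ^+ 2 = 2 by rewrite /q sqr_sqrtr.
  by move=> q2; rewrite -subr_sqr q2; ring.
have q0 : 0 <= q by exact: sqrtr_ge0.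
rewrite (eq_bigr (fun i : 'I_n => q ^+ i)); last by move=> i _; rewrite qE.
rewrite qE -[leLHS]mul1r -{1}q2 mulrAC -subrX1 mulrC ler_wpM2l ?addr_ge0//.
by rewrite gerBl.
Qed.

Lemma doubling_start c n : 0 < c -> round_start c doubling n <=
  2 ^+ n + Num.sqrt (2 / c) * ((Num.sqrt 2 + 1) * Num.sqrt (2 ^+ n)).
Proof.
move=> c0; rewrite /round_start.
rewrite (eq_bigr (fun i : 'I_n =>
  2 ^+ i + Num.sqrt (2 / c) * Num.sqrt (2 ^+ i))); last first.
  move=> i _; rewrite round_timeE// ?exprn_ge0// /doubling mulrAC sqrtrM//.
  by rewrite divr_ge0// ltW.
rewrite big_split/= -mulr_sumr lerD//.
  have := subrX1 (2 : R) n; rewrite (_ : 2 - 1 = 1); last by ring.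
  by rewrite mul1r => <-; rewrite gerBl.
by rewrite ler_wpM2l ?sqrtr_ge0// sum_sqrt_pow2.
Qed.

(** The 5 is 4 for the earlier rounds plus 1 for the final leg; the returns contribute only on the
    order of the square root. *)
Lemma doubling_reach_time c z : 0 < c -> 1 <= `|z| ->
  (reach_time c doubling z <=
    (5 * `|z| + 2 * Num.sqrt (2 / c) * (Num.sqrt 2 + 1) * Num.sqrt `|z|)%:E)%E.
Proof.
move=> c0 z1; have [k zk k4] := doubling_reaches z z1.
apply: le_trans (reach_time_le c doubling z k zk) _; rewrite lee_fin.
have := doubling_start c k c0.
have sk : Num.sqrt (2 ^+ k) <= 2 * Num.sqrt `|z|.
  have -> : 2 * Num.sqrt `|z| = Num.sqrt (4 * `|z|).
    have -> : 4 = 2 ^+ 2 :> R by ring.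
    by rewrite sqrtrM ?sqr_ge0// sqrtr_sqr normr_nat.
  by rewrite ler_wsqrtr.
have := ler_wpM2l (mulr_ge0 (sqrtr_ge0 (2 / c)) (addr_ge0 (sqrtr_ge0 2) ler01)) sk.
by nra.
Qed.

Lemma doubling_sigma c d : 0 < c -> 1 <= d ->
  (sigma c doubling d <=
    (5 + 2 * Num.sqrt (2 / c) * (Num.sqrt 2 + 1) * d `^ (- 2^-1))%:E)%E.
Proof.
move=> c0 d1; have d0 : 0 < d by lra.
rewrite sigma_le// powRN powR12_sqrt ?(ltW d0)//.
set C := 2 * _ * _.
have -> : (5 + C * (Num.sqrt d)^-1) * d = 5 * d + C * Num.sqrt d.
  rewrite mulrDl; congr (_ + _); rewrite -{2}[d]sqr_sqrtr ?(ltW d0)//; field.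
  by rewrite gt_eqF// sqrtr_gt0.
have reach z : `|z| = d ->
    (reach_time c doubling z <= (5 * d + C * Num.sqrt d)%:E)%E.
  by move=> zd; rewrite -zd; apply: doubling_reach_time; rewrite // zd.
by rewrite !reach ?normrN ?gtr0_norm.
Qed.

End Doubling.

(** * Lower bound for every strategy *)

Section LowerBound.
Context {R : realType}.
Implicit Types (c d M mu : R) (X S : nat -> R).

Lemma no_slow_growth S mu : 0 < mu -> mu < 4 -> (forall n, 0 < S n) ->
  (forall n, S n <= S n.+1) ->
  (forall n, S n.+2 <= mu * (S n.+1 - S n)) -> False.
Proof.
move=> mu0 mu4 S0 S_incr Smu; pose de := 1 - mu / 4.
have de0 : 0 < de by rewrite /de; lra.
have bound n : S n.+2 <= (mu - n%:R * de) * S n.+1.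
  elim: n => [|n IH].
    by rewrite mul0r subr0; have := Smu 0; have := S0 0; nra.
  set r := mu - n%:R * de in IH *.
  have -> : mu - n.+1%:R * de = r - de by rewrite /r -natr1; ring.
  (* Positivity of [S n.+2] and the induction hypothesis force [r > 0]. *)
  have r_gt0 : 0 < r by rewrite -(pmulr_lgt0 _ (S0 n.+1)); exact: lt_le_trans IH.
  have r_le : r <= mu by rewrite /r gerBl mulr_ge0// ltW.
  (* the quadratic r^2 - mu r + mu is at least mu - mu^2/4 = mu de >= r de *)
  have quad : mu * (r - 1) <= r * (r - de).
    have := sqr_ge0 (r - mu / 2); have : r * de <= mu * de by rewrite ler_pM2r.
    by rewrite /de; nra.
  rewrite -(ler_pM2l r_gt0).
  have h1 : r * S n.+3 <= r * (mu * (S n.+2 - S n.+1)) by rewrite ler_pM2l.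
  have h2 : mu * S n.+2 <= mu * (r * S n.+1) by rewrite ler_pM2l.
  have h3 := ler_wpM2r (ltW (S0 n.+2)) quad.
  by lra.
(* At this index the coefficient [mu - n%:R * de] is negative, contradicting positivity of [S]. *)
have := bound (Num.bound (mu / de)).
have := S0 (Num.bound (mu / de)).+2; have := S0 (Num.bound (mu / de)).+1.
have : mu < (Num.bound (mu / de))%:R * de.
  by rewrite -ltr_pdivrMr// archi_boundP// ltW// divr_gt0.
by set N := _%:R; nra.
Qed.

Lemma zigzag_le X j k : zigzag X -> (j <= k)%N -> odd j = odd k -> X j <= X k.
Proof.
move=> zX jk ojk.
have -> : k = (j + (k - j)./2.*2)%N.
  by rewrite even_halfK ?subnKC// oddB// ojk addbb.
elim: (_./2) => [|m IH]; first by rewrite addn0.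
by rewrite doubleS !addnS (le_trans IH)// ltW//; case: (zX (j + m.*2)%N).
Qed.

(** Returns are made free here, which removes the dependence on [c]. *)
Lemma le_round_start c X k : 0 < c -> zigzag X ->
  \sum_(i < k) X i <= round_start c X k.
Proof.
move=> c0 zX; apply: ler_sum => i _; have [Xi0 _] := zX i.
by rewrite round_timeE ?(ltW Xi0)// lerDl sqrtr_ge0.
Qed.

(** The side is encoded by a boolean [b] so that it can be compared with the parity of a round. *)
Lemma competitive_ratio_reach c X M : (competitive_ratio c X <= M%:E)%E ->
  forall b d, 1 < d ->
  (reach_time c X (if b then - d else d)%R <= (M * d)%:E)%E.
Proof.
move=> XM b d d1; have d0 : 0 < d by lra.
have : (sigma c X d <= M%:E)%E.
  by apply: le_trans XM; apply: ereal_sup_ubound; exists d.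
by rewrite sigma_le// => /andP[]; case: b.
Qed.

Lemma round_reachesE X b d k : 0 < d ->
  round_reaches X (if b then - d else d) k = (odd k == b) && (d <= X k).
Proof.
move=> d0; rewrite /round_reaches; case: b.
  by rewrite oppr_lt0 d0 normrN gtr0_norm.
by rewrite ltNge ltW//= gtr0_norm.
Qed.

(** Only targets with [d > 1] are constrained by the ratio. A finite ratio forces both targets at
    distance 2 to be reached, and monotonicity on each side does the rest. *)
Lemma ratio_eventually_gt1 c X M : zigzag X ->
  (competitive_ratio c X <= M%:E)%E ->
  exists K, forall k, (K <= k)%N -> 1 < X k.
Proof.
move=> zX XM.
have ex b : exists2 j, odd j = b & 2 <= X j.
  apply: contrapT => noj.
  have : (reach_time c X (if b then - 2 else 2)%R <= (M * 2)%:E)%E.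
    by apply: competitive_ratio_reach => //; lra.
  suff /le_trans/[apply] : (+oo <= reach_time c X (if b then - 2 else 2)%R)%E by [].
  apply: le_reach_time => k; rewrite round_reachesE// => /andP[/eqP kb kX].
  by case: noj; exists k.
have [j0 oj0 Xj0] := ex false; have [j1 oj1 Xj1] := ex true.
exists (maxn j0 j1) => k; rewrite geq_max => /andP[j0k j1k].
have [ok|ok] := boolP (odd k).
  by have := zigzag_le X j1 k zX j1k; rewrite oj1 ok => /(_ erefl); lra.
by have := zigzag_le X j0 k zX j0k; rewrite oj0 (negbTE ok) => /(_ erefl); lra.
Qed.

(** A target just beyond [X k] on the side of round [k] is found in round [k.+2] at the earliest,
    after all rounds up to [k.+1]. *)
Lemma ratio_sum_le c X M k : 0 < c -> zigzag X -> 1 < M ->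
  (competitive_ratio c X <= M%:E)%E -> 1 < X k ->
  \sum_(i < k.+2) X i <= (M - 1) * X k.
Proof.
move=> c0 zX M1 XM Xk1; set S := \sum_(i < k.+2) X i.
have SM d : X k < d -> S <= (M - 1) * d.
  move=> Xkd; have d0 : 0 < d by lra.
  suff : ((S + d)%:E <= (M * d)%:E)%E by rewrite lee_fin; lra.
  apply: le_trans (competitive_ratio_reach c X M XM (odd k) d _); last by lra.
  apply: le_reach_time => j; rewrite round_reachesE// => /andP[/eqP jk dj].
  have kj : (k < j)%N.
    rewrite ltnNge; apply/negP => /(zigzag_le X j k zX)/(_ jk); lra.
  have k2j : (k.+2 <= j)%N.
    by rewrite ltn_neqAle kj andbT; apply: contra_eqN jk => /eqP <-/=; case: odd.
  rewrite lee_fin (_ : `|_| = d); last by case: (odd k); rewrite ?normrN gtr0_norm.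
  rewrite lerD2r; apply: le_trans (le_round_start c X j c0 zX).
  rewrite -(subnKC k2j) big_split_ord/= lerDl; apply: sumr_ge0 => i _.
  by rewrite ltW//; case: (zX (k.+2 + i)%N).
(* Instead of letting [d] tend to [X k], the midpoint of [X k] and [S / (M - 1)] serves as [d]. *)
rewrite leNgt; apply/negP => XkS.
have m0 : 0 < M - 1 by lra.
have Xd : X k < S / (M - 1) by rewrite ltr_pdivlMr// mulrC.
have := SM ((X k + S / (M - 1)) / 2).
have -> : (M - 1) * ((X k + S / (M - 1)) / 2) = ((M - 1) * X k + S) / 2.
  by field; lra.
by lra.
Qed.

Lemma competitive_ratio_ge5 c X : 0 < c -> zigzag X ->
  (5%:E <= competitive_ratio c X)%E.
Proof.
move=> c0 zX; rewrite leNgt; apply/negP => X5.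
(* Taking [M >= 2] keeps [M - 1] positive and also covers the formal value [-oo]. *)
have [M [M2 M5 XM]] : exists M, [/\ 2 <= M, M < 5 & (competitive_ratio c X <= M%:E)%E].
  case: (competitive_ratio c X) X5 => [r|//|_].
    rewrite lte_fin => r5; exists (Num.max r 2); split.
    - by rewrite le_max lexx orbT.
    - by rewrite gt_max r5; lra.
    - by rewrite lee_fin le_max lexx.
  by exists 2; split=> //; rewrite ?leNye//; lra.
have [K XK] := ratio_eventually_gt1 c X M zX XM.
(* The shift by [K] puts each increment of [S] beyond 1, and [n.+1] makes [S 0] a nonempty sum. *)
pose S n := \sum_(i < K + n.+1) X i.
have SE n : S n.+1 = S n + X (K + n.+1)%N by rewrite /S [(K + n.+2)%N]addnS big_ord_recr.
have X0 n : 0 < X n by case: (zX n).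
apply: (no_slow_growth S (M - 1)); [lra|lra| | |] => n.
- rewrite /S addnS big_ord_recr/= ltr_wpDl// sumr_ge0// => i _.
  exact: ltW.
- by rewrite SE lerDl ltW.
- have -> : S n.+1 - S n = X (K + n.+1)%N by rewrite SE addrC addKr.
  have -> : S n.+2 = \sum_(i < (K + n.+1).+2) X i by rewrite /S !addnS.
  by apply: (ratio_sum_le c) => //; [lra|apply: XK; exact: leq_addr].
Qed.

End LowerBound.

Theorem theorem7 (R : realType) (c : R) (hc : 0 < c) :
  (exists C : R, forall d : R, 1 <= d ->
     (sigma c doubling d <= (5 + C * d `^ (- 2^-1))%:E)%E) /\
  (5%:E <= optimal_ratio c)%E.
Proof.
split; first by eexists => d d1; exact: doubling_sigma.
by apply: le_ereal_inf_tmp => _ [X zX <-]; exact: competitive_ratio_ge5.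
Qed.
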